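(* For every integer $n\ge 0$, as polynomials in $x$, $$H_n(x)=\sum_{F\in\mathcal{F}(n)}\ \prod_{v\in V(F)}\frac{(2h_v-1)x+1-h_v}{h_v}=\frac{1}{2n+1}\binom{(2n+1)x}{n},$$ where $\binom{y}{n}=y(y-1)\cdots(y-n+1)/n!$.
   Context: A plane tree is a rooted tree with unlabelled vertices in which the children of each vertex are linearly ordered. A plane forest is a linearly ordered sequence of plane trees; $\mathcal{F}(n)$ is the set of plane forests with $n$ vertices in total ($\mathcal{F}(0)$ consists of the empty forest). $V(F)$ is the vertex set of $F$, and for $v\in V(F)$ the hook length $h_v$ is the number of vertices in the subtree rooted at $v$ (including $v$). The empty product is $1$, so $H_0(x)=1$. *)

(* Defs.v *)
From HB Require Import structures.
From mathcomp Require Import all_boot all_order all_algebra.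

Set Implicit Arguments.
Unset Strict Implicit.
Unset Printing Implicit Defensive.

Import GRing.Theory.

Inductive plane_tree : Type := Node of seq plane_tree.

Notation plane_forest := (seq plane_tree).

(* The automatically generated induction principle of [plane_tree] gives no
   hypothesis on the children. *)
Lemma plane_tree_forest_ind (P : plane_tree -> Prop) (Q : plane_forest -> Prop) :
    Q [::] -> (forall t F, P t -> Q F -> Q (t :: F)) ->
    (forall F, Q F -> P (Node F)) ->
  (forall t, P t) /\ (forall F, Q F).
Proof.
move=> Q0 QS PN.
have PT : forall t, P t.
  fix IH 1 => -[F]; apply: PN; elim: F => [|t F IHF]; first exact: Q0.
  by apply: QS; [exact: IH | exact: IHF].
by split=> //; elim=> [|t F IHF]; [exact: Q0 | exact: QS].
Qed.

Fixpoint gentree_of_plane (t : plane_tree) : GenTree.tree unit :=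
  let: Node F := t in GenTree.Node 0 (map gentree_of_plane F).

Fixpoint plane_of_gentree (g : GenTree.tree unit) : plane_tree :=
  if g is GenTree.Node _ s then Node (map plane_of_gentree s) else Node [::].

Lemma gentree_of_planeK : cancel gentree_of_plane plane_of_gentree.
Proof.
apply: (proj1 (@plane_tree_forest_ind
  (fun t => plane_of_gentree (gentree_of_plane t) = t)
  (fun F => map plane_of_gentree (map gentree_of_plane F) = F) _ _ _)) => //=.
  by move=> t F -> ->.
by move=> F ->.
Qed.

HB.instance Definition _ :=
  Countable.copy plane_tree (can_type gentree_of_planeK).

(* A vertex is encoded by its path from the top: [i :: p] is the vertex [p] of
   the [i]-th tree of a forest, [[::]] is the root of a tree, and the other
   vertices of [Node F] are those of the forest [F] of its root's subtrees. *)
Definition graft (Vs : seq (seq (seq nat))) : seq (seq nat) :=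
  [seq i :: p | i <- iota 0 (size Vs), p <- nth [::] Vs i].

Fixpoint tree_vertices (t : plane_tree) : seq (seq nat) :=
  let: Node F := t in [::] :: graft (map tree_vertices F).

Definition vertices (F : plane_forest) : seq (seq nat) :=
  graft (map tree_vertices F).

Lemma graft_uniq Vs : all uniq Vs -> uniq (graft Vs).
Proof.
move=> /all_nthP-/(_ [::]) UVs; apply: allpairs_uniq_dep; first exact: iota_uniq.
  by move=> i; rewrite mem_iota => /andP[_ iVs]; apply: UVs.
by move=> [i p] [j q] _ _ /= [-> ->].
Qed.

Lemma vertices_uniq F : uniq (vertices F).
Proof.
apply: graft_uniq; move: F.
apply: (proj2 (@plane_tree_forest_ind (fun t => uniq (tree_vertices t))
  (fun F => all uniq (map tree_vertices F)) _ _ _)) => //= [t F -> //|F UF].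
by rewrite graft_uniq // andbT; apply/negP => /allpairsPdep[i [p []]].
Qed.

(* The vertices of the subtree rooted at [v] are those whose path extends [v]. *)
Definition hook (F : plane_forest) (v : seq nat) : nat :=
  count (prefix v) (vertices F).

Record forest_of_order (n : nat) : Type := ForestOfOrder {
  forest_val :> plane_forest;
  _ : size (vertices forest_val) == n
}.

HB.instance Definition _ n := [isSub for @forest_val n].
HB.instance Definition _ n := [Countable of forest_of_order n by <:].

Lemma size_graft Vs : size (graft Vs) = sumn (map size Vs).
Proof.
rewrite size_allpairs_dep -[Vs in RHS](mkseq_nth [::]) /mkseq -map_comp.
by [].
Qed.

Lemma size_vertices_cons A B :
  size (vertices (Node A :: B)) = (size (vertices A) + size (vertices B)).+1.
Proof. by rewrite /vertices !size_graft /= size_graft. Qed.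

(* [d] is fuel; the enumeration is complete as soon as [n <= d]. *)
Fixpoint enum_forests (d n : nat) : seq plane_forest :=
  match n, d with
  | 0, _ => [:: [::]]
  | _, 0 => [::]
  | m.+1, d'.+1 =>
      flatten [seq [seq Node A :: B | A <- enum_forests d' k,
                                      B <- enum_forests d' (m - k)]
              | k <- iota 0 m.+1]
  end.

Lemma mem_enum_forests d F :
  size (vertices F) <= d -> F \in enum_forests d (size (vertices F)).
Proof.
elim: d F => [|d IHd] [|[A] B] //; rewrite size_vertices_cons // ltnS => leABd.
apply/flatten_mapP; exists (size (vertices A)).
  by rewrite mem_iota ltnS leq_addr.
apply/allpairsP; exists (A, B); rewrite addKn; split=> //=; apply: IHd.
  exact: leq_trans (leq_addr _ _) leABd.
exact: leq_trans (leq_addl _ _) leABd.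
Qed.

Definition forest_enum n : seq (forest_of_order n) :=
  pmap insub (undup (enum_forests n n)).

Lemma forest_enum_uniq n : uniq (forest_enum n).
Proof. exact: pmap_sub_uniq (undup_uniq _). Qed.

Lemma mem_forest_enum n : forest_enum n =i predT.
Proof.
move=> F; rewrite mem_pmap_sub mem_undup inE.
case: F => F /= /eqP sF; have := @mem_enum_forests n F.
by rewrite sF; apply.
Qed.

HB.instance Definition _ n := isFinite.Build (forest_of_order n)
  (Finite.uniq_enumP (@forest_enum_uniq n) (@mem_forest_enum n)).

Local Open Scope ring_scope.

Definition H (n : nat) : {poly rat} :=
  \sum_(F : forest_of_order n) \prod_(v <- vertices F)
    (let h := (hook F v)%:R : rat in
     h^-1 *: ((2 * h - 1) *: 'X + 1 - h%:P)).

Definition binom_poly (y : {poly rat}) (n : nat) : {poly rat} :=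
  n`!%:R^-1 *: \prod_(i < n) (y - i%:R).

(* Main.v *)
(* Splitting a nonempty forest into the forest A below its first root and the
   forest B of its remaining trees gives, with h the hook length #A + 1,
     H_(n+1) = sum_k ((2k+1)x - k)/(k+1) H_k H_(n-k).
   The Gould polynomials G_n(a) = a/(a+bn) binom(a+bn, n) satisfy
   G_(n+1)(a+1) - G_(n+1)(a) = G_n(a+b), whence Rothe's convolution identity
   sum_j G_j(a) G_(n-j)(c) = G_n(a+c).  For b = 2x the claimed value of H_n is
   G_n(x), the factor ((2k+1)x - k)/(k+1) turns G_k(x) into -G_(k+1)(-x), and
   the recurrence is Rothe's identity at a = -x, c = x, where G_(n+1)(0) = 0. *)
Require Import Defs.
From mathcomp Require Import all_boot all_order all_algebra.
From mathcomp Require Import ring.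

Import GRing.Theory.
Local Open Scope ring_scope.

(** Renumbers a vertex when one more tree is put in front of its forest. The value at the empty path
    is a dummy: no vertex of a forest is encoded by it. *)
Definition shift_head (v : seq nat) : seq nat :=
  if v is i :: p then i.+1 :: p else [::].

Lemma graft_cons V Vs :
  graft (V :: Vs) = map (cons 0%N) V ++ map shift_head (graft Vs).
Proof.
rewrite /graft /= -[1%N]/(1 + 0)%N iotaDl /allpairs_dep -map_comp map_flatten.
by rewrite -map_comp; congr (_ ++ flatten _); apply: eq_map => i /=; rewrite -map_comp.
Qed.

Lemma vertices_cons A B :
  vertices (Node A :: B) =
  [:: 0%N] :: map (cons 0%N) (vertices A) ++ map shift_head (vertices B).
Proof. by rewrite /vertices /= graft_cons. Qed.

Lemma nil_notin_vertices F : [::] \notin vertices F.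
Proof. by apply/negP => /allpairsPdep[i [p []]]. Qed.

Lemma count_prefix_shift0 p (s : seq (seq nat)) :
  count (prefix (0%N :: p)) (map shift_head s) = 0%N.
Proof. by rewrite count_map -[RHS](count_pred0 s); apply: eq_count => -[]. Qed.

Lemma hook_root A B : hook (Node A :: B) [:: 0%N] = (size (vertices A)).+1.
Proof.
rewrite /hook vertices_cons /= count_cat count_prefix_shift0 addn0 count_map.
by rewrite -(count_predT (vertices A)) (@eq_count _ _ predT) // => p; exact: prefix0s.
Qed.

(** All extensions of [0 :: p] lie in the first tree. As [p] is nonempty, the root [[:: 0]] is not
    among them, so deleting the leading [0] matches them with the extensions of [p] in [A]. *)
Lemma hook_below A B p :
  p != [::] -> hook (Node A :: B) (0%N :: p) = hook A p.
Proof.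
case: p => // i p _.
by rewrite /hook vertices_cons /= count_cat count_prefix_shift0 addn0 count_map.
Qed.

Lemma hook_after A B v :
  v != [::] -> hook (Node A :: B) (shift_head v) = hook B v.
Proof.
case: v => // i p _; rewrite /hook vertices_cons /= count_cat !count_map.
rewrite (@eq_count _ _ pred0) ?count_pred0 ?add0n; last by [].
by apply: eq_count => -[|j q].
Qed.

Lemma prod_hook_cons (R : comPzRingType) (g : nat -> R) A B :
  \prod_(v <- vertices (Node A :: B)) g (hook (Node A :: B) v) =
  g (size (vertices A)).+1 * \prod_(v <- vertices A) g (hook A v)
    * \prod_(v <- vertices B) g (hook B v).
Proof.
rewrite {1}vertices_cons big_cons big_cat !big_map hook_root mulrA /=.
congr (_ * _ * _); apply: eq_big_seq => v vF.
  by rewrite hook_below //; apply: contraNneq (nil_notin_vertices A) => <-.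
by rewrite hook_after //; apply: contraNneq (nil_notin_vertices B) => <-.
Qed.

(** Lists of bare forests, free of the dependent type, so that sums over different orders can be
    reindexed by [perm_big]. *)
Definition forests (n : nat) : seq plane_forest :=
  [seq val F | F <- enum {: forest_of_order n}].

Lemma forests_uniq n : uniq (forests n).
Proof. by rewrite map_inj_uniq ?enum_uniq //; exact: val_inj. Qed.

Lemma mem_forests n F : (F \in forests n) = (size (vertices F) == n).
Proof.
apply/mapP/idP => [[G _ ->]|sF]; first exact: (valP G).
by exists (Sub F sF); rewrite ?mem_enum ?SubK.
Qed.

Lemma big_forestsS (R : nmodType) n (f : plane_forest -> R) :
  \sum_(F <- forests n.+1) f F =
  \sum_(k < n.+1) \sum_(A <- forests k) \sum_(B <- forests (n - k))
     f (Node A :: B).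
Proof.
pose s := [seq Node p.1 :: p.2 | k <- iota 0 n.+1,
                                 p <- [seq (A, B) | A <- forests k, B <- forests (n - k)]].
have Es : perm_eq (forests n.+1) s.
  apply: uniq_perm; first exact: forests_uniq.
    apply: allpairs_uniq_dep => [|k _|]; first exact: iota_uniq.
      by apply: allpairs_uniq => [||[? ?] [? ?]]; rewrite ?forests_uniq.
    (* The index [k] is recovered from the forest as the number of vertices of [A], so no forest
       arises from two values of [k]. *)
    move=> ? ? /allpairsPdep[k [_ [_ /allpairsP[[A B] [Ak _ ->]] ->]]].
    move=> /allpairsPdep[l [_ [_ /allpairsP[[C D] [/= Cl _ ->]] ->]]] /= [AC BD].
    move: Ak Cl; rewrite !mem_forests => /eqP <- /eqP <-.
    by rewrite AC BD.
  move=> F; rewrite mem_forests; apply/idP/allpairsPdep.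
    case: F => [|[A] B]; rewrite // size_vertices_cons eqSS => /eqP <-.
    exists (size (vertices A)), (A, B); split => //.
      by rewrite mem_iota ltnS leq_addr.
    by apply/allpairsP; exists (A, B); rewrite !mem_forests addKn !eqxx.
  move=> [k [_ [+ /allpairsP[[A B] [/= + + ->]] ->]]].
  rewrite mem_iota add0n ltnS !mem_forests size_vertices_cons => lekn.
  by move=> /eqP -> /eqP ->; rewrite subnKC.
rewrite (perm_big _ Es) big_allpairs_dep.
have -> : iota 0 n.+1 = index_iota 0 n.+1 by rewrite /index_iota subn0.
by rewrite big_mkord; apply: eq_bigr => k _; rewrite big_allpairs_dep.
Qed.

Lemma forests0 : forests 0 = [:: [::]].
Proof.
apply/perm_small_eq => //; apply: uniq_perm => //; first exact: forests_uniq.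
by move=> [|[A] B]; rewrite mem_forests ?size_vertices_cons.
Qed.

Definition hook_weight (h : nat) : {poly rat} :=
  h%:R^-1 *: ((2 * h%:R - 1) *: 'X + 1 - (h%:R)%:P).

Lemma H_forests n :
  H n = \sum_(F <- forests n) \prod_(v <- vertices F) hook_weight (hook F v).
Proof. by rewrite /forests big_map big_enum. Qed.

Lemma H0 : H 0 = 1.
Proof. by rewrite H_forests forests0 big_seq1 big_nil. Qed.

Lemma H_rec n : H n.+1 = \sum_(k < n.+1) hook_weight k.+1 * H k * H (n - k).
Proof.
rewrite H_forests big_forestsS; apply: eq_bigr => k _.
rewrite !H_forests -mulrA mulr_suml mulr_sumr; apply: eq_big_seq => A.
rewrite mem_forests => /eqP sA; rewrite mulrA mulr_sumr.
by apply: eq_bigr => B _; rewrite prod_hook_cons sA.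
Qed.

(** In characteristic 0 the naturals below the size of [p - q] are that many distinct roots, more
    than its degree allows unless it is zero. *)
Lemma poly_eq_nat (R : numDomainType) (p q : {poly R}) :
  (forall n : nat, p.[n%:R] = q.[n%:R]) -> p = q.
Proof.
move=> pq; apply/eqP; rewrite -subr_eq0; apply/eqP.
apply: (@roots_geq_poly_eq0 _ _ [seq i%:R | i <- iota 0 (size (p - q))]).
- by apply/allP => _ /mapP[i _ ->]; rewrite rootE !hornerE pq subrr.
- by rewrite map_inj_uniq ?iota_uniq // => i j /eqP; rewrite Num.Theory.eqr_nat => /eqP.
- by rewrite size_map size_iota.
Qed.

Section Gould.
Context {R : numFieldType}.
Implicit Types (a b c x : R) (n : nat).

(* G_n(a) = a/(a+bn) binom(a+bn, n), with the denominator a + bn cancelled. *)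
Definition gould b n : {poly R} :=
  if n is m.+1 then
    n`!%:R^-1 *: ('X * \prod_(i < m) ('X + (b * n%:R - i.+1%:R)%:P))
  else 1.

Lemma hornerS_gould b n a :
  (gould b n.+1).[a] =
  n.+1`!%:R^-1 * (a * \prod_(i < n) (a + b * n.+1%:R - i.+1%:R)).
Proof.
rewrite hornerZ hornerM hornerX horner_prod; congr (_ * (_ * _)).
by apply: eq_bigr => i _; rewrite hornerD hornerX hornerC addrA.
Qed.

Lemma gould_at0 b n : (gould b n).[0] = (n == 0%N)%:R.
Proof. by case: n => [|n]; rewrite ?hornerC // hornerS_gould mul0r mulr0. Qed.

(** For [n = m.+1], all three terms contain the product [P] of the [a + b(m+2) - i] for
    [1 <= i <= m]. What is left is [(a+1)(a+b(m+2)) - a(a+b(m+2)-(m+1)) = (m+2)(a+b)]. *)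
Lemma gould_diff b n a :
  (gould b n.+1).[a + 1] = (gould b n.+1).[a] + (gould b n).[a + b].
Proof.
case: n => [|n]; first by rewrite !hornerS_gould !big_ord0 hornerC invr1 !mul1r !mulr1.
rewrite !hornerS_gould big_ord_recl big_ord_recr /=.
set P := \prod_(i < n) (a + b * _ - _).
rewrite (eq_bigr (fun i : 'I_n => a + b * n.+2%:R - i.+1%:R)); last first.
  by move=> i _; rewrite /bump add1n; ring.
rewrite -/P [X in _ = _ + _ * (_ * X)](eq_bigr (fun i : 'I_n => a + b * n.+2%:R - i.+1%:R)); last first.
  by move=> i _; ring.
rewrite -/P (factS n.+1) natrM invfM.
have f0 : n.+1`!%:R != 0 :> R by rewrite Num.Theory.pnatr_eq0 -lt0n fact_gt0.
field.
by rewrite f0 -natrD Num.Theory.pnatr_eq0.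
Qed.

(** By induction on [n], both sides, as polynomials in [a], have the same first difference and the
    same value at 0. Hence they agree at every natural number. *)
Lemma rothe b n a c :
  \sum_(j < n.+1) (gould b j).[a] * (gould b (n - j)).[c] = (gould b n).[a + c].
Proof.
elim: n a c => [|n IHn] a c.
  by rewrite big_ord1 !hornerC mulr1.
pose p := \sum_(j < n.+2) (gould b (n.+1 - j)).[c] *: gould b j.
have pE y : p.[y] = \sum_(j < n.+2) (gould b j).[y] * (gould b (n.+1 - j)).[c].
  by rewrite horner_sum; apply: eq_bigr => j _; rewrite hornerZ mulrC.
have p_diff y : p.[y + 1] = p.[y] + (gould b n).[y + b + c].
  (* The term [j = 0] does not depend on [y] and cancels; [gould_diff] turns the others into the
     convolution of order [n] at [y + b]. *)
  rewrite !pE -IHn !(big_ord_recl n.+1) /= !hornerC -addrA; congr (_ + _).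
  rewrite -big_split; apply: eq_bigr => j _ /=.
  by rewrite /bump add1n subSS gould_diff mulrDl.
rewrite -pE; suff -> : p = gould b n.+1 \Po ('X + c%:P).
  by rewrite horner_comp hornerD hornerX hornerC.
apply: poly_eq_nat; elim=> [|m IHm].
  rewrite horner_comp hornerD hornerX hornerC add0r pE big_ord_recl gould_at0 mul1r subn0.
  by rewrite big1 ?addr0 // => j _; rewrite gould_at0 mul0r.
rewrite -natr1 p_diff IHm !horner_comp !hornerD !hornerX !hornerC [in RHS]addrAC gould_diff.
by congr (_ + _.[_]); rewrite addrAC.
Qed.

(** With [b = 2x], [-x + b(n+1) = x + bn], so both products run over the same factors. For [n > 0]
    the one on the right has one more, [x + bn - n], which is the numerator of the weight. *)
Lemma gould_neg x n :
  n.+1%:R^-1 * ((2 * n.+1%:R - 1) * x + 1 - n.+1%:R) * (gould (2 * x) n).[x] =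
  - (gould (2 * x) n.+1).[- x].
Proof.
case: n => [|n].
  rewrite hornerS_gould hornerC big_ord0 !invr1; ring.
rewrite !hornerS_gould big_ord_recr /=.
rewrite [X in _ = - (_ * (_ * (X * _)))](eq_bigr (fun i : 'I_n => x + 2 * x * n.+1%:R - i.+1%:R)); last first.
  by move=> i _; ring.
rewrite (factS n.+1) natrM invfM; ring.
Qed.

Lemma gould_rec x n :
  (gould (2 * x) n.+1).[x] =
  \sum_(k < n.+1) - (gould (2 * x) k.+1).[- x] * (gould (2 * x) (n - k)).[x].
Proof.
have := rothe (2 * x) n.+1 (- x) x.
rewrite addNr gould_at0 big_ord_recl hornerC mul1r subn0 => /eqP.
rewrite addr_eq0 => /eqP ->; rewrite -sumrN.
by apply: eq_bigr => k _; rewrite mulNr.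
Qed.

End Gould.

(** The parameter [b = 2x] varies with the evaluation point, so the induction compares values at a
    fixed [x] instead of polynomials. *)
Lemma horner_H n (x : rat) : (H n).[x] = (gould (2 * x) n).[x].
Proof.
elim/ltn_ind: n => -[|n] IHn; first by rewrite H0.
rewrite H_rec horner_sum gould_rec; apply: eq_bigr => k _.
rewrite !hornerM IHn ?ltn_ord // IHn ?ltnS ?leq_subr // -gould_neg.
by rewrite /hook_weight !hornerE.
Qed.

Theorem theorem4p1 :
  forall n : nat,
    H n = (2 * n + 1)%N%:R^-1 *: binom_poly ((2 * n + 1)%N%:R *: 'X) n.
Proof.
move=> n; apply: poly_eq_nat => m; rewrite horner_H.
set x : rat := m%:R; rewrite /binom_poly !hornerZ horner_prod.
case: n => [|n]; first by rewrite hornerC big_ord0 invr1 !mulr1.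
(* The factor of index 0 in the binomial is [(2(n+1)+1)x]: its constant cancels the prefactor and
   its [x] is the leading factor of [gould]. *)
rewrite hornerS_gould big_ord_recl.
rewrite [in RHS](eq_bigr (fun i : 'I_n => x + 2 * x * n.+1%:R - i.+1%:R)); last first.
  move=> i _; rewrite -polyC_natr !hornerE lift0; ring.
rewrite subr0 hornerZ hornerX.
have d0 : (2 * n.+1 + 1)%:R != 0 :> rat by rewrite Num.Theory.pnatr_eq0 addn1.
by rewrite [RHS]mulrCA -!mulrA mulKf.
Qed.
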